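(* Let $U\neq\emptyset$ be a set, $m\geq1$, and $F,G_1,\ldots,G_m\colon U\to\mathbb{R}\cup\{+\infty\}$. For $\alpha\in[0,+\infty)^m$ let $H_\alpha\colon U\to\mathbb{R}\cup\{+\infty\}$, $H_\alpha(u):=F(u)+\sum_{j=1}^m\alpha_jG_j(u)$, and assume that there exist $\bar u\in U$ and $\bar\alpha\in(0,+\infty)^m$ with $H_{\bar\alpha}(\bar u)<+\infty$. Let $\mathcal{H}\colon[0,+\infty)^m\to\mathbb{R}\cup\{-\infty\}$, $\mathcal{H}(\alpha):=\inf_{u\in U}H_\alpha(u)$, be the value function, and let $G_\alpha^{j,+},G_\alpha^{j,-}$ ($j=1,\ldots,m$) be the quantities defined in the context. Let $\mathcal{O}\subset[0,+\infty)^m$ be an open subset of $\mathbb{R}^m$ such that $\mathcal{H}(\alpha)>-\infty$ for every $\alpha\in\mathcal{O}$. Then, for every $j=1,\ldots,m$ and every $\alpha\in\mathcal{O}$, the following are equivalent: (1) the partial derivative $\partial_j\mathcal{H}(\alpha)$ exists, i.e., $\partial_j^+\mathcal{H}(\alpha)=\partial_j^-\mathcal{H}(\alpha)$; (2) the identity $G_\alpha^{j,+}=G_\alpha^{j,-}$ holds; (3) the function $\alpha'\mapsto G_{\alpha'}^{j,+}$ is continuous at $\alpha$; (4) the function $\alpha'\mapsto G_{\alpha'}^{j,-}$ is continuous at $\alpha$. Finally, the value function $\mathcal{H}$ is differentiable at $\alpha\in\mathcal{O}$ if and only if $G_\alpha^{j,+}=G_\alpha^{j,-}$ for every $j=1,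\ldots,m$.
   Context: For $\alpha\in[0,+\infty)^m$, $S_\alpha$ denotes the set of all minimizing sequences of $H_\alpha$, i.e. sequences $(u_i)_{i\in\mathbb{N}}$ in $U$ with $\lim_{i\to\infty}H_\alpha(u_i)=\inf_{u\in U}H_\alpha(u)$. For $j=1,\ldots,m$ set $$G_\alpha^{j,+}:=\sup_{(u_i)\in S_\alpha}\limsup_{i\to\infty}G_j(u_i),\qquad G_\alpha^{j,-}:=\inf_{(u_i)\in S_\alpha}\liminf_{i\to\infty}G_j(u_i).$$ With $e_j$ the $j$-th standard basis vector of $\mathbb{R}^m$, for $\alpha\in\mathcal{O}$, $$\partial_j^+\mathcal{H}(\alpha):=\lim_{h\to0^+}\frac{\mathcal{H}(\alpha+he_j)-\mathcal{H}(\alpha)}{h},\qquad \partial_j^-\mathcal{H}(\alpha):=\lim_{h\to0^+}\frac{\mathcal{H}(\alpha-he_j)-\mathcal{H}(\alpha)}{-h};$$ these limits exist because $\mathcal{H}$ is concave. Convention: $0\cdot(+\infty)=0$. *)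

(* Defs.v *)
From HB Require Import structures.
From mathcomp Require Import all_boot all_order all_algebra.
From mathcomp Require Import all_classical all_reals all_analysis.
Set Implicit Arguments.
Unset Strict Implicit.
Unset Printing Implicit Defensive.
Import Order.TTheory GRing.Theory Num.Theory.
Import numFieldNormedType.Exports.
Local Open Scope classical_set_scope.
Local Open Scope ring_scope.

Definition orthant (R : realType) (m : nat) : set 'rV[R]_m :=
  [set alpha | forall j, 0 <= alpha ord0 j].

Section value_function.
Context (R : realType) (U : Type) (m : nat).
Context (F : U -> \bar R) (G : 'I_m -> U -> \bar R).
Implicit Types (alpha : 'rV[R]_m) (j : 'I_m).

(* The parameter set of the problem is [orthant]; the functions below are total
   on R^m, and their values off the orthant carry no meaning. On the orthant,
   the library convention 0 * +oo = 0 is the intended one. *)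
Definition Hfun alpha (u : U) : \bar R :=
  (F u + \sum_(j < m) (alpha ord0 j)%:E * G j u)%E.

Definition value alpha : \bar R := ereal_inf (range (Hfun alpha)).

Definition minimizing alpha : set (nat -> U) :=
  [set u | Hfun alpha (u i) @[i --> \oo] --> value alpha].

Definition Gplus j alpha : \bar R :=
  ereal_sup [set limn_esup (fun i => G j (u i)) | u in minimizing alpha].

Definition Gminus j alpha : \bar R :=
  ereal_inf [set limn_einf (fun i => G j (u i)) | u in minimizing alpha].

(* [value] seen as a real-valued function; only meaningful where [value] is
   finite, [fine] being 0 on infinite values. *)
Definition valueR alpha : R := fine (value alpha).

Definition right_quotient j alpha (h : R) : R :=
  (valueR (alpha + h *: delta_mx ord0 j) - valueR alpha) / h.

Definition left_quotient j alpha (h : R) : R :=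
  (valueR (alpha - h *: delta_mx ord0 j) - valueR alpha) / (- h).

Definition right_partial j alpha : R :=
  lim (right_quotient j alpha h @[h --> 0^'+]).

Definition left_partial j alpha : R :=
  lim (left_quotient j alpha h @[h --> 0^'+]).

End value_function.

(* Main.v *)
Require Import Defs.
From HB Require Import structures.
From mathcomp Require Import all_boot all_order all_algebra.
From mathcomp Require Import all_classical all_reals all_analysis.
From mathcomp Require Import lra.
Set Implicit Arguments.
Unset Strict Implicit.
Unset Printing Implicit Defensive.
Import Order.TTheory GRing.Theory Num.Theory.
Import numFieldNormedType.Exports.
Local Open Scope classical_set_scope.
Local Open Scope ring_scope.

(* On [O] all coordinates are positive, so [value] is there the infimum of the
   affine functions [alpha |-> F u + \sum_j alpha_j G_j u] over the [u] at which
   [F] and all the [G_j] are finite; in particular it is concave.  An almost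
   minimizer [u] at [a] has slope at least the difference quotient of the
   infimum in any direction [w], up to an error, so the one-sided derivative
   [dder w a], which is the supremum of these quotients, bounds the slopes along
   minimizing sequences from below; sufficiently good almost minimizers at
   [a + t w], as [t] tends to [0], attain the bound.  Hence [Gminus j] is the
   derivative in direction [e_j] and [Gplus j] is minus the derivative in
   direction [- e_j].  As a supremum of continuous quotients, [dder w] is lower
   semicontinuous, and concavity gives
   [- dder (- w) a <= dder w (a - t w)]; both together make continuity of
   [dder w] at [a] equivalent to [dder w a = - dder (- w) a].  If this holds in
   all coordinate directions, the gradients of all almost minimizers at [a] are
   uniformly close to one vector, which is then the Frechet derivative. *)

(** * Linear forms on row vectors, estimated in the sup norm *)

Section dot.
Context (R : realType) (m : nat).
Implicit Types (d : 'I_m -> R) (w : 'rV[R]_m).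

Definition dot d w : R := \sum_(j < m) w ord0 j * d j.

Fact dot_is_linear d : linear (dot d).
Proof.
move=> k w1 w2; rewrite /dot scaler_sumr -big_split; apply: eq_bigr => j _.
by rewrite !mxE mulrDl -mulrA.
Qed.

HB.instance Definition _ d :=
  GRing.isLinear.Build R 'rV[R]_m R *:%R (dot d) (dot_is_linear d).

Lemma dot_delta d j : dot d (delta_mx ord0 j) = d j.
Proof.
rewrite /dot (bigD1 j)//= big1 ?addr0 ?mxE ?eqxx ?mul1r// => i ij.
by rewrite mxE (negPf ij) andbF mul0r.
Qed.

Lemma coord_le_norm w j : `|w ord0 j| <= `|w|.
Proof.
rewrite [leRHS]mx_normrE.
exact: (le_bigmax _ (fun ij : 'I_1 * 'I_m => `|w ij.1 ij.2|) (ord0, j)).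
Qed.

Lemma dot_le_norm d w : `|dot d w| <= `|w| * \sum_(j < m) `|d j|.
Proof.
rewrite mulr_sumr (le_trans (ler_norm_sum _ _ _))//.
by apply: ler_sum => j _; rewrite normrM ler_wpM2r// coord_le_norm.
Qed.

Lemma dot_continuous d : continuous (dot d).
Proof.
apply: bounded_linear_continuous; apply/bounded_funP => r.
exists (r * \sum_(j < m) `|d j|) => w wr.
by rewrite (le_trans (dot_le_norm _ _))// ler_wpM2r// sumr_ge0.
Qed.

End dot.

Lemma near_distance (R : realType) (m : nat) (a : 'rV[R]_m) (e : R) :
  0 < e -> \forall b \near a, `|b - a| < e.
Proof.
move=> e0; apply/nbhs_ballP; exists e => // b.
by rewrite -ball_normE /= distrC.
Qed.

Lemma cvg_line (R : realType) (W : normedModType R) (a w : W) :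
  a + t *: w @[t --> (0 : R)] --> a.
Proof.
rewrite -[X in _ --> X]addr0 -(scale0r w).
by apply: cvgD; [exact: cvg_cst | apply: cvgZr_tmp; exact: cvg_id].
Qed.

(** * Concavity of an infimum of affine functions *)

Section envelope.
Context (R : realType) (U : Type) (m : nat) (V : set U) (f : U -> R).
Context (g : 'I_m -> U -> R) (v : 'rV[R]_m -> R) (O : set 'rV[R]_m).
Implicit Types (a b w : 'rV[R]_m) (u : U).

Definition slope w u : R := dot (g ^~ u) w.
Definition energy a u : R := f u + slope a u.

Hypothesis O_open : open O.
Hypothesis v_le : forall a u, O a -> V u -> v a <= energy a u.
Hypothesis v_adherent : forall a e, O a -> 0 < e ->
  exists2 u, V u & energy a u < v a + e.

Lemma slopeD w1 w2 u : slope (w1 + w2) u = slope w1 u + slope w2 u.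
Proof. exact: linearD. Qed.

Lemma slopeZ t w u : slope (t *: w) u = t * slope w u.
Proof. exact: linearZ. Qed.

Lemma slopeN w u : slope (- w) u = - slope w u.
Proof. exact: linearN. Qed.

Lemma energy_line a w t u : energy (a + t *: w) u = energy a u + t * slope w u.
Proof. by rewrite /energy slopeD slopeZ addrA. Qed.

Lemma energyB a b u : energy b u = energy a u + slope (b - a) u.
Proof. by rewrite /energy -addrA -slopeD [a + _]addrC subrK. Qed.

(** The energy is affine in the parameter, so an almost minimizer at [c] can be tested at [a] and
    [b] simultaneously. The weights are not normalized, which spares divisions later, and [O] need
    not be convex, so each point is required to lie in it. *)
Lemma v_concave (p q : R) a b c : O a -> O b -> O c -> 0 <= p -> 0 <= q ->
  0 < p + q -> p *: a + q *: b = (p + q) *: c ->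
  p * v a + q * v b <= (p + q) * v c.
Proof.
move=> Oa Ob Oc p0 q0 pq0 abc; rewrite -ler_pdivrMl//.
apply/ler_addgt0Pr => e e0; have [u Vu /ltW ule] := v_adherent Oc e0.
apply: le_trans ule; rewrite ler_pdivrMl//.
have -> : (p + q) * energy c u = p * energy a u + q * energy b u.
  rewrite /energy !mulrDr -!slopeZ -abc slopeD.
  by rewrite mulrDl addrACA.
by apply: lerD; apply: ler_wpM2l => //; exact: v_le.
Qed.

(** * One-sided directional derivatives *)

Definition quot w a (t : R) : R := (v (a + t *: w) - v a) / t.

(** By concavity the quotients grow as [t] decreases to 0, so their supremum is their limit; this
    form makes lower bounds immediate. *)
Definition dder w a : R :=
  sup [set quot w a t | t in [set t | 0 < t /\ O (a + t *: w)]].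

(** Concavity with [a + s *: w] between [a] and [a + t *: w], at weights [t - s] and [s]. *)
Lemma quot_le w a s t : 0 < s -> s <= t -> O a -> O (a + s *: w) ->
  O (a + t *: w) -> quot w a t <= quot w a s.
Proof.
move=> s0 st Oa Os Ot; have t0 := lt_le_trans s0 st.
have := @v_concave (t - s) s a (a + t *: w) (a + s *: w) Oa Ot Os.
rewrite subr_ge0 st (ltW s0) subrK => /(_ erefl erefl t0) H.
rewrite /quot ler_pdivlMr// mulrAC ler_pdivrMr//.
suff: (t - s) * v a + s * v (a + t *: w) <= t * v (a + s *: w) by lra.
apply: H; rewrite !scalerDr !scalerA (mulrC s t) addrA -scalerDl.
by rewrite subrK.
Qed.

(** Concavity with [a] between the two other points, at weights [t] and [s]. It bounds the quotients
    above, so that [dder] is a genuine supremum. *)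
Lemma quot_le_opp w a s t : 0 < s -> 0 < t -> O a -> O (a + s *: w) ->
  O (a + t *: - w) -> quot w a s <= - quot (- w) a t.
Proof.
move=> s0 t0 Oa Os Ot.
have := @v_concave t s (a + s *: w) (a + t *: - w) a Os Ot Oa (ltW t0) (ltW s0).
rewrite addr_gt0// => /(_ erefl) H.
rewrite /quot -mulNr ler_pdivlMr// mulrAC ler_pdivrMr//.
suff: t * v (a + s *: w) + s * v (a + t *: - w) <= (t + s) * v a by lra.
apply: H; rewrite !scalerDr !scalerA (mulrC s t) addrACA -scalerDl.
by rewrite scalerN subrr addr0.
Qed.

Lemma near_line a w : O a -> \forall t \near (0 : R)^'+, O (a + t *: w).
Proof.
move=> Oa; apply: cvg_within; apply: cvg_line.
exact: open_nbhs_nbhs.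
Qed.

Lemma exists_line a w (e : R) : O a -> 0 < e ->
  exists2 t : R, 0 < t < e & O (a + t *: w).
Proof.
move=> Oa e0.
have : \forall t \near (0 : R)^'+, 0 < t < e /\ O (a + t *: w).
  near=> t; split; last by near: t; exact: near_line.
  by apply/andP; split; near: t; [exact: nbhs_right_gt | exact: nbhs_right_lt].
by move=> /(@filter_ex _ _ _) [t [? ?]]; exists t.
Unshelve. all: by end_near. Qed.

Lemma dder_has_sup w a : O a ->
  has_sup [set quot w a t | t in [set t | 0 < t /\ O (a + t *: w)]].
Proof.
move=> Oa; split.
  have [t /andP[t0 _] Ot] := exists_line w Oa ltr01.
  by exists (quot w a t), t.
have [t /andP[t0 _] Ot] := exists_line (- w) Oa ltr01.
exists (- quot (- w) a t) => _ [s [s0 Os] <-].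
exact: quot_le_opp.
Qed.

Lemma quot_le_dder w a t : O a -> 0 < t -> O (a + t *: w) ->
  quot w a t <= dder w a.
Proof.
move=> Oa t0 Ot; apply: ub_le_sup; first exact: (dder_has_sup w Oa).2.
by exists t.
Qed.

Lemma dder_le_quotN w a t : O a -> 0 < t -> O (a + t *: - w) ->
  dder w a <= - quot (- w) a t.
Proof.
move=> Oa t0 Ot; apply: ge_sup; first exact: (dder_has_sup w Oa).1.
by move=> _ [s [s0 Os] <-]; exact: quot_le_opp.
Qed.

Lemma dder_leN w a : O a -> dder w a <= - dder (- w) a.
Proof.
move=> Oa; rewrite lerNr; apply: ge_sup; first exact: (dder_has_sup _ Oa).1.
by move=> _ [s [s0 Os] <-]; rewrite lerNr; exact: dder_le_quotN.
Qed.

Lemma quot_cvg w a : O a -> quot w a t @[t --> 0^'+] --> dder w a.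
Proof.
move=> Oa; apply/cvgrPdist_le => e e0.
have [_ [s [s0 Os] <-] /ltW qs] := sup_adherent e0 (dder_has_sup w Oa).
near=> t.
have t0 : 0 < t by near: t; exact: nbhs_right_gt.
have ts : t <= s by near: t; exact: nbhs_right_le.
have Ot : O (a + t *: w) by near: t; exact: near_line.
have qt : quot w a t <= dder w a by exact: quot_le_dder.
rewrite ger0_norm ?subr_ge0// lerBlDr -lerBlDl (le_trans qs)//.
exact: quot_le.
Unshelve. all: by end_near. Qed.

(** * Slopes of almost minimizers *)

Lemma near_min_slope w a e : O a -> 0 < e ->
  \forall d \near (0 : R)^'+,
    forall u, V u -> energy a u < v a + d -> dder w a - e < slope w u.
Proof.
move=> Oa e0; have e20 : 0 < e / 2 by rewrite divr_gt0.
have [_ [t [t0 Ot] <-] qt] := sup_adherent e20 (dder_has_sup w Oa).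
near=> d => u Vu ud.
(* One test point [a + t *: w] serves all [u]: an energy error below [t * (e / 2)] costs at most
   [e / 2] in the slope. *)
have dt : d < t * (e / 2) by near: d; apply: nbhs_right_lt; rewrite mulr_gt0.
have := v_le Ot Vu; rewrite energy_line => vt.
move: qt; rewrite -/(dder w a) /quot ltr_pdivlMr// => qt.
rewrite -(ltr_pM2l t0); lra.
Unshelve. all: by end_near. Qed.

(* The witness almost minimizes the energy at [a + t *: w] up to [t ^+ 2]:
   dividing by [t], its slope is at most [quot w a t + t]. *)
Lemma near_min_recovery w a e : O a -> 0 < e ->
  exists u, [/\ V u, energy a u < v a + e & `|slope w u - dder w a| < e].
Proof.
move=> Oa e0.
have [d [d0 de dP]] : exists d, [/\ 0 < d, d <= e & forall u, V u ->
    energy a u < v a + d -> dder w a - e < slope w u].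
  suff : \forall d \near (0 : R)^'+, [/\ 0 < d, d <= e & forall u, V u ->
      energy a u < v a + d -> dder w a - e < slope w u].
    by move=> /(@filter_ex _ _ _).
  near=> d; split; last by near: d; exact: near_min_slope.
    by near: d; exact: nbhs_right_gt.
  by near: d; exact: nbhs_right_le.
have [T /andP[T0 T1] OT] := exists_line w Oa ltr01.
(* [T] is a fixed far point on the line. The bound [t * K < d * T] is what extrapolating the energy
   from [a + t *: w] back to [a] requires; [K + 1] keeps the divisor positive. *)
set D := dder w a; pose K := 2 * (T * (`|D| + 1) + `|v (a + T *: w) - v a|).
have K0 : 0 <= K by rewrite mulr_ge0// addr_ge0// mulr_ge0 ?addr_ge0// ltW.
have c0 : 0 < Num.min (Num.min e (T / 2)) (d * T / (K + 1)).
  by rewrite !lt_min e0 divr_gt0//= divr_gt0 ?mulr_gt0 ?ltr_wpDl.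
have [t /andP[t0 +] Ot] := exists_line w Oa c0.
rewrite !lt_min => /andP[/andP[te tT]]; rewrite ltr_pdivlMr ?ltr_wpDl// => tK.
have [u Vu ut] := v_adherent Ot (mulr_gt0 t0 t0).
have tD := quot_le_dder Oa t0 Ot.
have {}tD : v (a + t *: w) - v a <= D * t by rewrite -ler_pdivrMr.
(* The energy is affine along the line: its upper bound at [a + t *: w] and its lower bound at
   [a + T *: w] together bound it above at [a]. *)
have ud : energy a u < v a + d.
  have vT := v_le OT Vu; rewrite !energy_line in vT ut.
  have Tt0 : 0 < T - t by lra.
  suff : (T - t) * energy a u < (T - t) * (v a + d) by rewrite ltr_pM2l.
  have : (T - t) * energy a u <
      T * (v a + D * t + t * t) - t * v (a + T *: w) by nra.
  move=> /lt_le_trans; apply.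
  have D1 : D <= `|D| := ler_norm D.
  have D2 : - (v (a + T *: w) - v a) <= `|v (a + T *: w) - v a|.
    by rewrite -normrN; exact: ler_norm.
  have h1 : T * (D * t) <= T * (`|D| * t).
    by rewrite ler_pM2l// ler_pM2r.
  have h2 : t * (- (v (a + T *: w) - v a)) <= t * `|v (a + T *: w) - v a|.
    by rewrite ler_pM2l.
  have h3 : T * (t * t) <= T * t by rewrite ler_pM2l// ler_piMr ?ltW//; lra.
  have h4 : d * T / 2 <= (T - t) * d by nra.
  have h5 : 2 * (T * (`|D| * t) + t * `|v (a + T *: w) - v a| + T * t) <= d * T.
    by rewrite /K in tK; lra.
  by lra.
exists u; split => //; first by rewrite (lt_le_trans ud)// lerD2l.
rewrite ltr_distl dP//=.
have va := v_le Oa Vu; rewrite energy_line in ut.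
by rewrite -(ltr_pM2l t0); nra.
Unshelve. all: by end_near. Qed.

Lemma near_min_seq w a : O a -> exists s : nat -> U,
  [/\ forall i, V (s i), energy a (s i) @[i --> \oo] --> v a &
      slope w (s i) @[i --> \oo] --> dder w a].
Proof.
move=> Oa.
have /choice[s sP] : forall i : nat, exists u, [/\ V u,
    energy a u < v a + i.+1%:R^-1 & `|slope w u - dder w a| < i.+1%:R^-1].
  by move=> i; apply: near_min_recovery.
exists s; split; first by move=> i; have [] := sP i.
- apply/cvgrPdist_lt => e e0; near=> i.
  have [Vs sv _] := sP i; rewrite ler0_norm ?subr_le0 ?v_le// opprB ltrBlDl.
  by apply: (lt_trans sv); rewrite ltrD2l; near: i; exact: (near_infty_natSinv_lt (PosNum e0)).
- apply/cvgrPdist_lt => e e0; near=> i.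
  have [_ _] := sP i; rewrite distrC => /lt_trans; apply.
  by near: i; exact: (near_infty_natSinv_lt (PosNum e0)).
Unshelve. all: by end_near. Qed.

(** * Coercivity of the energy and continuity of [v] *)

(* [v] is bounded below on the vertices of a cube around [a]; the vertex whose
   signs are opposite to those of [g ^~ u] gives the bound. *)
Lemma energy_coercive a : O a -> exists r c, 0 < r /\
  forall u, V u -> r * \sum_(j < m) `|g j u| <= energy a u - c.
Proof.
move=> Oa.
have /nbhs_ballP[r /= r0 rO] : nbhs a O by exact: open_nbhs_nbhs.
pose sg (s : {ffun 'I_m -> bool}) : 'rV[R]_m := \row_j (-1) ^+ s j.
have sgO s : O (a + (r / 2) *: sg s).
  apply: rO; rewrite -ball_normE /= opprD addNKr normrN normrZ.
  rewrite gtr0_norm ?divr_gt0//.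
  have sg1 : `|sg s| <= 1.
    rewrite [leLHS]mx_normrE; apply/bigmax_le => // -[i j] _.
    by rewrite mxE normrX normrN1 expr1n.
  by have := ler_wpM2l (ltW (divr_gt0 r0 (ltr0n R 2))) sg1; lra.
(* The half radius keeps all vertices in the ball; summing over every vertex makes the lower bound
   independent of [u]. *)
exists (r / 2), (- \sum_s `|v (a + (r / 2) *: sg s)|).
split=> [|u Vu]; first by rewrite divr_gt0.
pose s : {ffun 'I_m -> bool} := [ffun j => 0 <= g j u].
have := v_le (sgO s) Vu; rewrite energy_line.
have -> : slope (sg s) u = - \sum_(j < m) `|g j u|.
  rewrite /slope /dot -sumrN; apply: eq_bigr => j _; rewrite mxE ffunE.
  have [gj|gj] := leP 0 (g j u).
    by rewrite expr1 mulN1r ger0_norm.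
  by rewrite expr0 mul1r ltr0_norm// opprK.
have : - \sum_s `|v (a + (r / 2) *: sg s)| <= v (a + (r / 2) *: sg s).
  rewrite lerNl (le_trans (ler_norm _))// normrN (bigD1 s)//= lerDl.
  exact: sumr_ge0.
by lra.
Qed.

(** Coercivity bounds the change of energy by the energy at [a] itself. For [b] close to [a], almost
    minimizers at [b] thus have controlled energy at [a], without any uniform bound on slopes. *)
Lemma energy_ge a : O a -> exists r c, 0 < r /\ forall b u, V u ->
  energy a u - `|b - a| / r * (energy a u - c) <= energy b u.
Proof.
move=> Oa; have [r [c [r0 rc]]] := energy_coercive Oa.
exists r, c; split=> // b u /rc gu.
rewrite (energyB a b) lerD2l lerNl -mulrA.
rewrite (le_trans (ler_norm _))// normrN (le_trans (dot_le_norm _ _))//.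
by rewrite ler_wpM2l// ler_pdivlMl.
Qed.

Lemma v_continuous a : O a -> {for a, continuous v}.
Proof.
move=> Oa; apply/(@cvgrPdist_lt _ _ _ (nbhs a)) => e e0.
have [r [c [r0 rc]]] := energy_ge Oa.
have e20 : 0 < e / 2 by rewrite divr_gt0.
have [u Vu ue] := v_adherent Oa e20.
pose S := \sum_(j < m) `|g j u|; have S0 : 0 <= S by exact: sumr_ge0.
near=> b.
have Ob : O b by near: b; exact: open_nbhs_nbhs.
have bS : `|b - a| * (S + 1) < e / 2.
  rewrite -ltr_pdivlMr ?ltr_wpDl//; near: b.
  by apply: near_distance; rewrite divr_gt0 ?ltr_wpDl.
have br : `|b - a| < r by near: b; exact: near_distance.
have bc : `|b - a| * (`|v a - c| + 1) < e * r.
  rewrite -ltr_pdivlMr ?ltr_wpDl//; near: b.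
  by apply: near_distance; rewrite divr_gt0 ?ltr_wpDl ?mulr_gt0.
rewrite distrC ltr_norml; apply/andP; split; last first.
  have := v_le Ob Vu; rewrite (energyB a b).
  have := ler_norm (slope (b - a) u).
  have := dot_le_norm (g ^~ u) (b - a); rewrite -/S.
  have := normr_ge0 (b - a); nra.
have t1 : `|b - a| / r < 1 by rewrite ltr_pdivrMr// mul1r.
have t0 : 0 <= `|b - a| / r by rewrite divr_ge0// ltW.
have te : `|b - a| / r * (`|v a - c| + 1) < e.
  by rewrite mulrAC ltr_pdivrMr.
have tn : `|b - a| / r * (v a - c) <= `|b - a| / r * `|v a - c|.
  by rewrite ler_wpM2l// ler_norm.
(* This tolerance at [b] is chosen so that the terms in [c] cancel when [energy_ge] is applied. *)
have h0 : 0 < (e - `|b - a| / r * (v a - c)) by lra.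
have [w Vw wb] := v_adherent Ob h0.
have := rc b w Vw; have := v_le Oa Vw; set t := `|b - a| / r in t0 t1 te tn h0 wb *.
by nra.
Unshelve. all: by end_near. Qed.

(** * Dependence of the directional derivatives on the base point *)

Lemma dder_lsc w a e : O a -> 0 < e ->
  \forall b \near a, dder w a - e < dder w b.
Proof.
move=> Oa e0.
have [_ [t [t0 Ot] <-] qt] := sup_adherent e0 (dder_has_sup w Oa).
have shift_cvg : b + t *: w @[b --> a] --> a + t *: w.
  by apply: (@cvgD _ _ _ (nbhs a)); [exact: cvg_id | exact: cvg_cst].
have qcvg : quot w b t @[b --> a] --> quot w a t.
  apply: (@cvgM _ _ (nbhs a)); last exact: (@cvg_cst R).
  apply: (@cvgB _ _ _ (nbhs a)); last exact: (v_continuous Oa).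
  exact: (cvg_comp _ _ shift_cvg (v_continuous Ot)).
near=> b.
have Ob : O b by near: b; exact: open_nbhs_nbhs.
have Obt : O (b + t *: w) by near: b; apply: shift_cvg; exact: open_nbhs_nbhs.
apply: lt_le_trans (quot_le_dder Ob t0 Obt).
by near: b; exact: cvgr_gt qcvg _ qt.
Unshelve. all: by end_near. Qed.

(** The segment from [a - t *: w] to [a] gives one quotient, read forwards at its first end and
    backwards at its second. *)
Lemma dderN_le_shift w a t : O a -> 0 < t -> O (a + t *: - w) ->
  - dder (- w) a <= dder w (a + t *: - w).
Proof.
move=> Oa t0 Ot; have aE : a + t *: - w + t *: w = a.
  by rewrite scalerN subrK.
have := quot_le_dder (w := w) Ot t0; rewrite aE => /(_ Oa).
apply: le_trans; have := quot_le_dder Oa t0 Ot.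
by rewrite /quot aE -lerN2 -mulNr opprB.
Qed.

Lemma dder_continuousP w a : O a ->
  {for a, continuous (dder w)} <-> dder w a = - dder (- w) a.
Proof.
move=> Oa; split=> [dc|dE].
  apply/eqP; rewrite eq_le dder_leN//=.
  have line : a + t *: - w @[t --> (0 : R)^'+] --> a.
    by apply: cvg_within_filter; exact: cvg_line.
  have dline := cvg_comp _ _ line dc.
  rewrite -(cvg_lim _ dline)//; apply: limr_ge; first exact: cvgP dline.
  near=> t; apply: dderN_le_shift => //.
  by near: t; exact: near_line.
apply/(@cvgrPdist_lt _ _ _ (nbhs a)) => e e0; near=> b.
have Ob : O b by near: b; exact: open_nbhs_nbhs.
(* Semicontinuity for [w] gives the lower estimate; that for [- w], with
   [dder w b <= - dder (- w) b], gives the upper one. *)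
have h1 : dder w a - e < dder w b by near: b; exact: dder_lsc.
have h2 : dder (- w) a - e < dder (- w) b by near: b; exact: dder_lsc.
have h3 := dder_leN w Ob.
by rewrite ltr_norml; apply/andP; split; lra.
Unshelve. all: by end_near. Qed.

(** * Frechet differentiability *)

Lemma near_min_gradient a (d : 'I_m -> R) e : O a -> 0 < e ->
  (forall j, dder (delta_mx ord0 j) a = d j) ->
  (forall j, dder (- delta_mx ord0 j) a = - d j) ->
  exists2 h, 0 < h & forall u, V u -> energy a u < v a + h ->
    forall w, `|slope w u - dot d w| <= e * `|w|.
Proof.
(* The [m] coordinate errors must add up to at most [e]; dividing by [m.+1] also covers [m = 0]. *)
move=> Oa e0 dP dN; pose e' := e / m.+1%:R.
have e'0 : 0 < e' by rewrite divr_gt0.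
have : \forall h \near (0 : R)^'+, 0 < h /\ forall j u, V u ->
    energy a u < v a + h -> `|g j u - d j| <= e'.
  near=> h; split; first by near: h; exact: nbhs_right_gt.
  near: h; apply: filter_forall => j; near=> h => u Vu uh.
  have : dder (delta_mx ord0 j) a - e' < slope (delta_mx ord0 j) u.
    by move: u Vu uh; near: h; exact: near_min_slope.
  have : dder (- delta_mx ord0 j) a - e' < slope (- delta_mx ord0 j) u.
    by move: u Vu uh; near: h; exact: near_min_slope.
  by rewrite slopeN /slope dot_delta dP dN ler_norml => ? ?; apply/andP; split; lra.
move=> /(@filter_ex _ _ _) [h [h0 hP]]; exists h => // u Vu uh w.
rewrite /slope /dot -sumrB (le_trans (ler_norm_sum _ _ _))//.
have le_e : \sum_(j < m) e' * `|w| <= e * `|w|.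
  rewrite sumr_const card_ord -mulr_natr mulrAC ler_wpM2r//.
  by rewrite /e' mulrAC ler_pdivrMr// ler_wpM2l ?ler_nat// ltW.
apply: le_trans le_e; apply: ler_sum => j _.
rewrite -mulrBr normrM mulrC ler_pM// ?coord_le_norm//.
exact: hP uh.
Unshelve. all: by end_near. Qed.

Lemma v_frechet a (d : 'I_m -> R) e : O a -> 0 < e ->
  (forall j, dder (delta_mx ord0 j) a = d j) ->
  (forall j, dder (- delta_mx ord0 j) a = - d j) ->
  \forall b \near a,
    `|v b - v a - dot d (b - a)| <= e * `|b - a|.
Proof.
move=> Oa e0 dP dN.
have [h h0 hP] := near_min_gradient Oa e0 dP dN.
have [r [c [r0 rc]]] := energy_ge Oa.
have h40 : 0 < h / 4 by rewrite divr_gt0.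
near=> b.
have Ob : O b by near: b; exact: open_nbhs_nbhs.
set D := dot d (b - a).
rewrite ler_norml; apply/andP; split.
  suff : v a + D - e * `|b - a| <= v b by lra.
  apply/ler_addgt0Pr => n n0; pose k := Num.min n (h / 4).
  have k0 : 0 < k by rewrite lt_min n0.
  have [u Vu ub] := v_adherent Ob k0.
  have kn : k <= n by rewrite ge_min lexx.
  have kh : k <= h / 4 by rewrite ge_min lexx orbT.
  (* By [energy_ge], an almost minimizer at [b] is one at [a] too, so its gradient is also close to
     [d]. *)
  have uh : energy a u < v a + h.
    have vb : v b < v a + h / 4.
      near: b; apply: (cvgr_lt (v a)); first exact: v_continuous.
      by rewrite ltrDl.
    have := rc b u Vu; set t := `|b - a| / r => tb.
    have t0 : 0 <= t by rewrite divr_ge0// ltW.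
    have t1 : t < 1.
      by rewrite ltr_pdivrMr// mul1r; near: b; exact: near_distance.
    have th : t * (`|v a + h - c| + 1) < h / 2.
      rewrite -ltr_pdivlMr ?ltr_wpDl// ltr_pdivrMr//.
      by near: b; apply: near_distance; rewrite mulr_gt0// !divr_gt0// ltr_wpDl.
    have tn : t * (v a + h - c) <= t * `|v a + h - c|.
      by rewrite ler_wpM2l// ler_norm.
    suff : (1 - t) * energy a u < (1 - t) * (v a + h).
      by rewrite ltr_pM2l// subr_gt0.
    by lra.
  have := v_le Oa Vu; rewrite (energyB a b) in ub.
  have := hP u Vu uh (b - a); rewrite -/D ler_norml => /andP[? ?] ?.
  by lra.
(* The upper estimate tests an almost minimizer at [a] in the parameter [b]. *)
suff : v b <= v a + D + e * `|b - a| by lra.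
apply/ler_addgt0Pr => n n0; pose k := Num.min n h.
have k0 : 0 < k by rewrite lt_min n0.
have kn : k <= n by rewrite ge_min lexx.
have kh : k <= h by rewrite ge_min lexx orbT.
have [u Vu ua] := v_adherent Oa k0.
have := v_le Ob Vu; rewrite (energyB a b).
have := hP u Vu (lt_le_trans ua _) (b - a); rewrite lerD2l => /(_ kh).
by rewrite -/D ler_norml => /andP[? ?] ?; lra.
Unshelve. all: by end_near. Qed.

Lemma differentiable_dder a w : O a -> differentiable v a ->
  dder w a = 'd v a w.
Proof.
move=> Oa dv; rewrite -(cvg_lim _ (quot_cvg (w := w) Oa))// -deriveE//.
apply: cvg_lim => //.
have /cvg_dnbhs_at_right := diff_derivable (v := w) dv.
apply: cvg_trans; apply: near_eq_cvg; near=> t.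
by rewrite /quot /= [a + _]addrC mulrC.
Unshelve. all: by end_near. Qed.

Lemma v_differentiable a : O a ->
  (forall j, dder (delta_mx ord0 j) a = - dder (- delta_mx ord0 j) a) ->
  differentiable v a.
Proof.
move=> Oa dE; pose d j := dder (delta_mx ord0 j) a.
have dN j : dder (- delta_mx ord0 j) a = - d j by rewrite /d dE opprK.
have vE : v \o shift a = cst (v a) + dot d +o_ (0 : 'rV[R]_m) id.
  apply/eqaddoP => e e0.
  have shift_cvg : h + a @[h --> (0 : 'rV[R]_m)] --> a.
    rewrite -[X in _ --> X]add0r.
    by apply: (@cvgD _ _ _ (nbhs (0 : 'rV[R]_m))); [exact: cvg_id | exact: cvg_cst].
  have := shift_cvg _ (v_frechet Oa e0 (fun=> erefl) dN).
  apply: (@filterS _ (nbhs (0 : 'rV[R]_m))) => h /=.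
  by rewrite addrK opprD addrA.
have dfE := diff_unique (@dot_continuous _ _ d) vE.
apply/diff_locallyP; rewrite dfE; split=> //; exact: dot_continuous.
Qed.

End envelope.

(** * Limits and continuity in the extended reals *)

Lemma limn_einf_ge (R : realType) (w : nat -> \bar R) (x : \bar R) :
  (\forall i \near \oo, (x <= w i)%E) -> (x <= limn_einf w)%E.
Proof.
move=> [N _ xw]; rewrite limn_einf_lim.
apply: lime_ge; first exact: is_cvg_einfs.
exists N => // n /= Nn; apply: le_ereal_inf_tmp => _ [k /= nk <-].
by apply: xw; exact: leq_trans nk.
Qed.

Lemma limn_esup_le (R : realType) (w : nat -> \bar R) (x : \bar R) :
  (\forall i \near \oo, (w i <= x)%E) -> (limn_esup w <= x)%E.
Proof.
move=> wx; rewrite -leeN2 -limn_einfN; apply: limn_einf_ge.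
by apply: filterS wx => i; rewrite leeN2.
Qed.

(** Carries continuity of [Gplus] and [Gminus] over to the real functions that represent them only
    on the neighbourhood [O] of the point. *)
Lemma EFin_continuousP (R : realType) (T : topologicalType) (a : T)
    (k : T -> \bar R) (h : T -> R) :
  (\forall b \near a, k b = (h b)%:E) ->
  {for a, continuous k} <-> {for a, continuous h}.
Proof.
move=> kh; rewrite /prop_for /continuous_at (nbhs_singleton kh).
have fk : \forall b \near a, fine (k b) = h b.
  by apply: filterS kh => b ->.
split=> [/fine_cvgP[_]|hc].
  by apply: cvg_trans; exact: near_eq_cvg.
apply/fine_cvgP; split; first by apply: filterS kh => b ->.
apply: cvg_trans hc; apply: near_eq_cvg.
by apply: filterS fk => b /= ->.
Qed.

(** * The value function as an infimum of affine functions *)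

Section value_function.
Context (R : realType) (U : Type) (m : nat).
Context (F : U -> \bar R) (G : 'I_m -> U -> \bar R) (O : set 'rV[R]_m).
Implicit Types (a b : 'rV[R]_m) (u : U) (j : 'I_m).

Hypothesis F_gtNy : forall u, (-oo < F u)%E.
Hypothesis G_gtNy : forall j u, (-oo < G j u)%E.
Hypothesis H_proper : exists (ubar : U) (abar : 'rV[R]_m),
  (forall j, 0 < abar ord0 j) /\ (Hfun F G abar ubar < +oo)%E.
Hypothesis O_orthant : O `<=` @orthant R m.
Hypothesis O_open : open O.
Hypothesis H_finite : forall a, O a -> (-oo < value F G a)%E.

(** For every parameter with positive coordinates this is the set where [Hfun] is finite, hence one
    index set for all of [O]. *)
Definition dom : set U :=
  [set u | F u \is a fin_num /\ forall j, G j u \is a fin_num].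

Local Notation fF := (fine \o F).
Local Notation gF := (fun j => fine \o G j).
Local Notation v := (valueR F G).
Local Notation en := (energy fF gF).
Local Notation dd := (dder v O).
Local Notation e_ j := (delta_mx ord0 j : 'rV[R]_m).

Lemma Hfun_dom a u : dom u -> Hfun F G a u = (en a u)%:E.
Proof.
move=> [Fu Gu]; rewrite /Hfun /energy EFinD /= fineK// /slope /dot -sumEFin.
by congr (_ + _)%E; apply: eq_bigr => j _; rewrite EFinM /= fineK.
Qed.

(** No term is [-oo], so nothing can cancel a [+oo]; positive weights are essential because
    [0 * +oo = 0]. *)
Lemma Hfun_lty_dom a u : (forall j, 0 < a ord0 j) ->
  (Hfun F G a u < +oo)%E -> dom u.
Proof.
move=> a0 Hu.
have aG j : ((a ord0 j)%:E * G j u != -oo)%E.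
  have := G_gtNy j u; case: (G j u) => [r||]// _.
  by rewrite gt0_muley// lte_fin.
have sumN : (\sum_(j < m) (a ord0 j)%:E * G j u != -oo)%E.
  by apply/eqP => /esum_eqNyP [j [_ _ jN]]; move: (aG j); rewrite jN.
have FN : (F u != -oo)%E by rewrite -ltNye.
split=> [|j].
  rewrite fin_numE FN /=; apply/eqP => Fy.
  by move: Hu; rewrite /Hfun Fy addye// ltxx.
rewrite fin_numE -ltNye G_gtNy /=; apply/eqP => Gy.
move: Hu; rewrite /Hfun.
have -> : (\sum_(j < m) (a ord0 j)%:E * G j u = +oo)%E.
  apply/esum_eqyP => //; exists j; split; rewrite ?mem_index_enum//.
  by rewrite Gy gt0_muley// lte_fin.
by rewrite addey// ltxx.
Qed.

Lemma O_pos a j : O a -> 0 < a ord0 j.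
Proof.
move=> Oa; have [t /andP[t0 _] Ot] := exists_line O_open (- e_ j) Oa ltr01.
by have := O_orthant Ot j; rewrite !mxE !eqxx /= mulrN1; lra.
Qed.

Lemma valueE a : O a -> value F G a = (v a)%:E.
Proof.
move=> Oa; rewrite /valueR fineK// fin_numElt H_finite//=.
(* The point where [Hfun] is finite at [b] lies in [dom], so it bounds the value above at [a] as
   well. *)
have [u [b [b0 /(Hfun_lty_dom b0) ud]]] := H_proper.
apply: (@le_lt_trans _ _ (Hfun F G a u)); first by apply: ereal_inf_lbound; exists u.
by rewrite Hfun_dom ?ltry.
Qed.

Lemma valueR_le a u : O a -> dom u -> v a <= en a u.
Proof.
move=> Oa ud; rewrite -lee_fin -valueE// -Hfun_dom//.
by apply: ereal_inf_lbound; exists u.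
Qed.

Lemma valueR_adherent a e : O a -> 0 < e ->
  exists2 u, dom u & en a u < v a + e.
Proof.
move=> Oa e0; have vfin : value F G a \is a fin_num by rewrite valueE.
have [_ [u _ <-] ue] := lb_ereal_inf_adherent e0 vfin.
rewrite -/(value F G a) valueE// -EFinD in ue.
have ud : dom u.
  apply: (@Hfun_lty_dom a); first by move=> j; exact: O_pos.
  by rewrite (lt_trans ue)// ltry.
by exists u; rewrite // -lte_fin -Hfun_dom.
Qed.

Lemma minimizing_near a s d : O a -> 0 < d -> minimizing F G a s ->
  \forall i \near \oo, dom (s i) /\ en a (s i) < v a + d.
Proof.
move=> Oa d0; rewrite /minimizing /= valueE// => sa.
have : \forall i \near \oo, (Hfun F G a (s i) < (v a + d)%:E)%E.
  apply: (sa [set x | (x < (v a + d)%:E)%E]).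
  apply: open_nbhs_nbhs; split; first exact: open_ereal_lt_ereal.
  by rewrite /= lte_fin ltrDl.
apply: filterS => i si.
have ud : dom (s i).
  apply: (@Hfun_lty_dom a); first by move=> j; exact: O_pos.
  by rewrite (lt_trans si)// ltry.
by split; rewrite // -lte_fin -Hfun_dom.
Qed.

Lemma minimizing_slope a s w e : O a -> 0 < e -> minimizing F G a s ->
  \forall i \near \oo, dom (s i) /\ dd w a - e < slope gF w (s i).
Proof.
move=> Oa e0 sa.
have := near_min_slope O_open valueR_le valueR_adherent w Oa e0.
have d_gt0 : \forall d \near (0 : R)^'+, 0 < d by exact: nbhs_right_gt.
move=> /(filterI d_gt0) /(@filter_ex _ _ _) [d [d0 dP]].
apply: filterS (minimizing_near Oa d0 sa) => i [sd se]; split=> //.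
exact: dP.
Qed.

Lemma minimizing_recovery a w : O a -> exists s, [/\ minimizing F G a s,
  forall i, dom (s i) & slope gF w (s i) @[i --> \oo] --> dd w a].
Proof.
move=> Oa.
have [s [sd sv sw]] := near_min_seq O_open valueR_le valueR_adherent w Oa.
exists s; split=> //; rewrite /minimizing /= valueE//.
under eq_fun do rewrite Hfun_dom//.
by apply/fine_cvgP; split=> //; exact: nearW.
Qed.

(** * The extremal limits as one-sided derivatives *)

Lemma GminusE j a : O a -> Gminus F G j a = (dd (e_ j) a)%:E.
Proof.
move=> Oa; apply/eqP; rewrite eq_le; apply/andP; split.
  have [s [sa sd sw]] := minimizing_recovery (e_ j) Oa.
  apply: ge_ereal_inf; exists (limn_einf (fun i => G j (s i))).
    by exists s.
  have /cvg_limn_einf_sup[-> _]// : G j (s i) @[i --> \oo] --> (dd (e_ j) a)%:E.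
  apply/fine_cvgP; split; first by apply: nearW => i; exact: (sd i).2.
  by apply: cvg_trans sw; apply: near_eq_cvg; apply: nearW => i;
    rewrite /slope dot_delta.
apply: le_ereal_inf_tmp => _ [s sa <-]; apply/lee_subgt0Pr => e e0.
apply: limn_einf_ge; apply: filterS (minimizing_slope (e_ j) Oa e0 sa) => i.
by rewrite /slope dot_delta => -[[_ sd] /ltW]; rewrite -lee_fin /= fineK.
Qed.

(** [G j] is minus the slope in direction [- e_ j], so lower bounds on that slope become upper
    bounds here. *)
Lemma GplusE j a : O a -> Gplus F G j a = (- dd (- e_ j) a)%:E.
Proof.
move=> Oa; apply/eqP; rewrite eq_le; apply/andP; split.
  apply: ge_ereal_sup => _ [s sa <-]; apply/lee_addgt0Pr => e e0.
  apply: limn_esup_le; apply: filterS (minimizing_slope (- e_ j) Oa e0 sa) => i.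
  rewrite slopeN /slope dot_delta => -[[_ sd]].
  by rewrite -ltrN2 opprB opprK addrC => /ltW; rewrite -lee_fin /= fineK.
have [s [sa sd sw]] := minimizing_recovery (- e_ j) Oa.
apply: le_ereal_sup_tmp; exists (limn_esup (fun i => G j (s i))).
  by exists s.
have /cvg_limn_einf_sup[_ ->]// :
  G j (s i) @[i --> \oo] --> (- dd (- e_ j) a)%:E.
apply/fine_cvgP; split; first by apply: nearW => i; exact: (sd i).2.
apply: cvg_trans (cvgN sw); apply: near_eq_cvg; apply: nearW => i /=.
by rewrite fctE slopeN opprK /slope dot_delta.
Qed.

Lemma right_quotient_cvg j a : O a ->
  right_quotient F G j a h @[h --> 0^'+] --> dd (e_ j) a.
Proof. by move=> Oa; exact: quot_cvg valueR_le valueR_adherent _ _ Oa. Qed.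

Lemma left_quotient_cvg j a : O a ->
  left_quotient F G j a h @[h --> 0^'+] --> - dd (- e_ j) a.
Proof.
move=> Oa.
apply: cvg_trans (cvgN (quot_cvg O_open valueR_le valueR_adherent Oa)).
apply: near_eq_cvg; apply: nearW => h /=.
by rewrite fctE /left_quotient /quot scalerN invrN mulrN.
Qed.

Lemma Gplus_continuousP j a : O a ->
  {for a, continuous (Gplus F G j)} <-> Gplus F G j a = Gminus F G j a.
Proof.
move=> Oa; have GE : \forall b \near a, Gplus F G j b = (- dd (- e_ j) b)%:E.
  have := open_nbhs_nbhs (conj O_open Oa).
  by apply: (@filterS _ (nbhs a)) => b; exact: GplusE.
have contN : {for a, continuous (fun b => - dd (- e_ j) b)} <->
    {for a, continuous (dd (- e_ j))}.
  exact: (@cvgNP _ _ _ (nbhs a) _ (dd (- e_ j))).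
rewrite (EFin_continuousP GE) contN.
rewrite (dder_continuousP O_open valueR_le valueR_adherent)// opprK.
rewrite GplusE// GminusE//.
by split=> [->|[<-]]; rewrite ?opprK.
Qed.

Lemma Gminus_continuousP j a : O a ->
  {for a, continuous (Gminus F G j)} <-> Gplus F G j a = Gminus F G j a.
Proof.
move=> Oa; have GE : \forall b \near a, Gminus F G j b = (dd (e_ j) b)%:E.
  have := open_nbhs_nbhs (conj O_open Oa).
  by apply: (@filterS _ (nbhs a)) => b; exact: GminusE.
rewrite (EFin_continuousP GE).
rewrite (dder_continuousP O_open valueR_le valueR_adherent)//.
by rewrite GplusE// GminusE//; split=> [->|[<-]].
Qed.

Lemma valueR_differentiableP a : O a ->
  differentiable v a <-> forall j, Gplus F G j a = Gminus F G j a.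
Proof.
move=> Oa; split=> [dv j|GE].
  rewrite GplusE// GminusE//.
  rewrite !(differentiable_dder O_open valueR_le valueR_adherent)//.
  by rewrite linearN opprK.
apply: (v_differentiable O_open valueR_le valueR_adherent) => // j.
by have := GE j; rewrite GplusE// GminusE// => -[].
Qed.

End value_function.

Theorem proposition6p2 (R : realType) (U : Type) (m : nat)
  (F : U -> \bar R) (G : 'I_m -> U -> \bar R) (O : set 'rV[R]_m)
  (U_neq0 : [set: U] !=set0) (m_gt0 : (0 < m)%N)
  (F_gtNy : forall u, (-oo < F u)%E)
  (G_gtNy : forall j u, (-oo < G j u)%E)
  (H_proper : exists (ubar : U) (abar : 'rV[R]_m),
    (forall j, 0 < abar ord0 j) /\ (Hfun F G abar ubar < +oo)%E)
  (O_orthant : O `<=` @orthant R m) (O_open : open O)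
  (H_finite : forall alpha, O alpha -> (-oo < value F G alpha)%E) :
  (forall (j : 'I_m) (alpha : 'rV[R]_m), O alpha ->
    [/\ cvg (right_quotient F G j alpha h @[h --> 0^'+]),
        cvg (left_quotient F G j alpha h @[h --> 0^'+]) &
        [<-> right_partial F G j alpha = left_partial F G j alpha;
             Gplus F G j alpha = Gminus F G j alpha;
             {for alpha, continuous (Gplus F G j)};
             {for alpha, continuous (Gminus F G j)}]]) /\
  (forall alpha : 'rV[R]_m, O alpha ->
    differentiable (valueR F G) alpha <->
    forall j : 'I_m, Gplus F G j alpha = Gminus F G j alpha).
Proof.
split=> [j a Oa|a Oa]; last exact: (valueR_differentiableP (O := O)).
have rc : right_quotient F G j a h @[h --> 0^'+] --> _ :=
  right_quotient_cvg F_gtNy G_gtNy H_proper O_orthant O_open H_finite Oa.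
have lc : left_quotient F G j a h @[h --> 0^'+] --> _ :=
  left_quotient_cvg F_gtNy G_gtNy H_proper O_orthant O_open H_finite Oa.
have GpE := Gplus_continuousP F_gtNy G_gtNy H_proper O_orthant O_open H_finite
  j Oa.
have GmE := Gminus_continuousP F_gtNy G_gtNy H_proper O_orthant O_open H_finite
  j Oa.
split; [exact: cvgP rc | exact: cvgP lc |].
(* The right partial is now the value of [Gminus] and the left one that of [Gplus], so (1) and (2)
   equate the same two reals. *)
rewrite /right_partial /left_partial (cvg_lim _ rc)// (cvg_lim _ lc)//.
tfae.
- by rewrite (GplusE (O := O))// (GminusE (O := O))// => ->.
- by move/GpE.
- by move/GpE/GmE.
- by move/GmE; rewrite (GplusE (O := O))// (GminusE (O := O))// => -[].
Qed.
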